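(* Let $G$ be a graph with $n$ edges and $m$ vertices, with a $\beta$-valuation $b$. Then there exists an $(n+1,m,1,1;G^b)$-EDF in $\mathbb{Z}_{n+1}$.
   Context: A $\beta$-valuation of a graph with $n$ edges is an injective $b:V\to\{0,\ldots,n\}$ such that the multiset of $|b(u)-b(v)|$ over edges $\{u,v\}$ is $\{1,\ldots,n\}$. $G^b$ (natural orientation) is the digraph obtained by orienting each edge towards the endpoint with larger $b$-label. $\Delta(A,B)=\{a-b:a\in A,b\in B\}$ (multiset). For a group $\Gamma$ of order $N$ and a digraph $H$ with $m$ vertices, a family $(A_v)_{v\in V(H)}$ of pairwise disjoint $l$-subsets of $\Gamma$ is an $(N,m,l,\lambda;H)$-EDF if $\bigcup_{(u,v)\in\overrightarrow{E}(H)}\Delta(A_v,A_u)=\lambda(\Gamma\setminus\{0\})$ as multisets; the first parameter is the group order. *)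

(* Defs.v *)
From mathcomp Require Import all_boot all_order all_fingroup all_algebra.

Set Implicit Arguments.
Unset Strict Implicit.
Unset Printing Implicit Defensive.

(* A finite simple graph on [V] is a symmetric irreflexive [e : rel V]; a
   digraph on [V] is any [H : rel V], with an arc from [u] to [v] iff [H u v].
   Multisets are sequences up to [perm_eq]. *)

Definition edges (V : finType) (e : rel V) : {set {set V}} :=
  [set [set p.1; p.2] | p : V * V & e p.1 p.2].

(* The maximum only turns |b u - b v| into a function of the unordered pair
   {u, v}: see [edge_label_set2]. *)
Definition edge_label (V : finType) (b : V -> nat) (f : {set V}) : nat :=
  \max_(u in f) \max_(v in f) `|b u - b v|%N.

Lemma edge_label_set2 (V : finType) (b : V -> nat) (u v : V) :
  edge_label b [set u; v] = `|b u - b v|%N.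
Proof.
apply/eqP; rewrite eqn_leq; apply/andP; split.
  apply/bigmax_leqP => x /set2P xuv; apply/bigmax_leqP => y /set2P yuv.
  by case: xuv => ->; case: yuv => ->; rewrite ?distnn // distnC.
apply: (bigmax_sup u); first exact: set21.
by apply: (bigmax_sup v); first exact: set22.
Qed.

Definition beta_valuation (V : finType) (e : rel V) (b : V -> nat) : Prop :=
  let n := #|edges e| in
  [/\ injective b,
      forall v, b v <= n
    & perm_eq [seq edge_label b f | f <- enum (edges e)] (iota 1 n)].

Definition natural_orientation (V : finType) (e : rel V) (b : V -> nat) :
    rel V :=
  [rel u v | e u v && (b u < b v)].

Definition arcs (V : finType) (H : rel V) : {set V * V} :=
  [set p | H p.1 p.2].

(* [finGroupType] is multiplicative: the difference a - b is [a * b^-1], and 0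
   is [1]. *)
Definition Delta (gT : finGroupType) (A B : {set gT}) : seq gT :=
  [seq (a * b^-1)%g | a <- enum A, b <- enum B].

Definition is_EDF (gT : finGroupType) (N m l lambda : nat) (V : finType)
    (H : rel V) (A : V -> {set gT}) : Prop :=
  [/\ #|gT| = N,
      #|V| = m,
      forall v, #|A v| = l,
      forall u v, u != v -> [disjoint A u & A v]
    & perm_eq (flatten [seq Delta (A p.2) (A p.1) | p <- enum (arcs H)])
              (flatten (nseq lambda (enum [set~ (1%g : gT)])))].

(* ['I_n.+1] carries the group of integers modulo [n.+1] under addition; unlike
   ['Z_n.+1] it is the trivial group when [n = 0]. *)
Lemma ord_group_subE (n : nat) (a b : 'I_n.+1) :
  (a * b^-1)%g = (a - b)%R /\ (1%g : 'I_n.+1) = 0%R.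
Proof. by []. Qed.

(* Main.v *)
(* Take A_v = {b v mod n+1}.  Along an arc the label increases, so the
   difference of its endpoints is the edge label |b u - b v| reduced mod n+1; each
   edge carries exactly one arc because b is injective, and the edge labels
   1, ..., n are the nonzero residues mod n+1. *)
Require Import Defs.
From mathcomp Require Import all_boot all_order all_fingroup all_algebra.

(** The inverse of [x] is represented by [n.+1 - x], and [y + (n.+1 - x)] exceeds [y - x] by exactly
    one modulus. *)
Lemma inord_divg (n x y : nat) (xy : x <= y) (yn : y <= n) :
  ((inord y : 'I_n.+1) * (inord x)^-1)%g = inord (y - x).
Proof.
have xn := leq_trans xy yn.
apply: val_inj => /=; rewrite !inordK ?ltnS //; last first.
  exact: leq_trans (leq_subr _ _) yn.
rewrite modnDmr addnBA; last exact: leqW.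
by rewrite addnC -addnBA // modnDl modn_small // ltnS (leq_trans (leq_subr _ _)).
Qed.

(** Reduction is injective on 1, ..., n, and each nonzero residue is the image of its own
    representative. *)
Lemma perm_inord_iota (n : nat) :
  perm_eq [seq inord i | i <- iota 1 n] (enum [set~ (1%g : 'I_n.+1)]).
Proof.
apply: uniq_perm; last 1 first.
- move=> i; rewrite mem_enum !inE.
  apply/mapP/idP => [[k] | i_neq0].
    rewrite mem_iota add1n ltnS => /andP[k_gt0 k_le] ->.
    by rewrite -val_eqE /= inordK ?ltnS // -lt0n.
  exists (val i); last by rewrite inord_val.
  by rewrite mem_iota add1n ltn_ord lt0n i_neq0.
- rewrite map_inj_in_uniq ?iota_uniq // => i j.
  rewrite !mem_iota !add1n => /andP[_ ilt] /andP[_ jlt] /(congr1 val).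
  by rewrite /= !inordK.
- exact: enum_uniq.
Qed.

(** The two ends of an edge have distinct labels, so exactly one of its two directions increases
    [b]. *)
Lemma perm_arcs_edges (V : finType) (e : rel V) (b : V -> nat)
    (e_sym : symmetric e) (e_irr : irreflexive e) (b_inj : injective b) :
  perm_eq [seq [set p.1; p.2] | p <- enum (arcs (natural_orientation e b))]
          (enum (edges e)).
Proof.
apply: uniq_perm; last 1 first.
- move=> f; rewrite mem_enum; apply/mapP/imsetP => [[p] | [[u v]]].
    by rewrite mem_enum !inE => /andP[euv _] ->; exists p; rewrite ?inE.
  rewrite inE /= => euv ->; case: (ltngtP (b u) (b v)) => [ltuv | ltvu | /b_inj uv].
  + by exists (u, v); rewrite // mem_enum inE /natural_orientation /= euv.
  + by exists (v, u); [rewrite mem_enum inE /natural_orientation /= e_sym euv | rewrite setUC].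
  + by rewrite uv e_irr in euv.
- rewrite map_inj_in_uniq ?enum_uniq // => -[u v] [x y].
  rewrite !mem_enum !inE /= => /andP[_ uv] /andP[_ xy] eq_uv_xy.
  have: u \in [set x; y] by rewrite -eq_uv_xy set21.
  have: v \in [set x; y] by rewrite -eq_uv_xy set22.
  (* Of the four ways to match the ends, two give a loop and one a reversed arc; each contradicts
     the strict increase of [b]. *)
  move=> /set2P[] ? /set2P[] ?; subst => //; first by rewrite ltnn in uv.
  + by have := ltn_trans uv xy; rewrite ltnn.
  + by rewrite ltnn in uv.
- exact: enum_uniq.
Qed.

Theorem theorem2p7 (V : finType) (e : rel V) (n m : nat) (b : V -> nat)
    (e_sym : symmetric e) (e_irr : irreflexive e)
    (card_edges : #|edges e| = n) (card_vertices : #|V| = m)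
    (b_beta : beta_valuation e b) :
  exists A : V -> {set 'I_n.+1},
    is_EDF n.+1 m 1 1 (natural_orientation e b) A.
Proof.
case: b_beta; rewrite card_edges => b_inj b_le labels.
exists (fun v => [set inord (b v)]); split=> //.
- exact: card_ord.
- by move=> v; rewrite cards1.
(* Labels are at most [n], so they survive reduction mod [n.+1] and equal residues force equal
   vertices. *)
- move=> u v; apply: contraNT.
  rewrite disjoints1 inE negbK => /eqP /(congr1 val) /=.
  by rewrite !inordK ?ltnS // => /b_inj ->.
have -> : flatten (nseq 1 (enum [set~ (1%g : 'I_n.+1)])) =
          enum [set~ (1%g : 'I_n.+1)] by rewrite /= cats0.
have -> : flatten [seq Delta [set inord (b p.2)] [set inord (b p.1)]
                  | p <- enum (arcs (natural_orientation e b))] =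
          [seq (inord i : 'I_n.+1) | i <- [seq edge_label b f | f <-
            [seq [set p.1; p.2] | p <- enum (arcs (natural_orientation e b))]]].
  (* Each [Delta] of two singletons is a one-element list; wrapping the right side likewise allows a
     comparison arc by arc. *)
  rewrite -!map_comp -[RHS]flatten_seq1 -map_comp; congr flatten.
  apply/eq_in_map => -[u v]; rewrite mem_enum !inE /= => /andP[_ uv].
  rewrite /Delta !enum_set1 /= inord_divg ?(ltnW uv) //.
  by rewrite edge_label_set2 distnC distnEl // ltnW.
(* Pass from arcs to edges, from edge labels to 1, ..., n, and from these to the nonzero
   residues. *)
apply: perm_trans (perm_inord_iota n); apply: perm_map.
by apply: perm_trans labels; apply: perm_map; apply: perm_arcs_edges.
Qed.
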